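(* Let $n,m,k,r,s$ be positive integers with $r\ge 2$ and $s\le k$. If $w(n,m;r,s)\ge k$ and $m(r-1)<n$, then $f(k,r,s)<n$.
   Context: For positive integers $n,m,r,s$, $w(n,m;r,s)$ denotes the maximum integer $k$ for which there exists a bipartite graph with parts $A$ of size $n$ and $B$ of size $m$ such that every vertex in $A$ has degree at least $k$, and any $r$ distinct vertices in $A$ have at most $s$ common neighbours. An $r$-graph is an $r$-uniform hypergraph. For positive integers $n,k,r,s$ with $r\ge2$ and $s\le k$, an $(n,k,r,s)$-graph is an $r$-graph whose vertex set is partitioned into $n$ disjoint parts of size $k$, such that any $r$ distinct parts induce exactly $s$ edges, each containing exactly one vertex from each of these $r$ parts, and such that these $s$ edges form a matching (are pairwise disjoint). An independent transversal of such a hypergraph is a set containing exactly one vertex from each part and not containing any edge. $f(k,r,s)$ denotes the maximum integer $n$ such that every $(n,k,r,s)$-graph has an independent transversal. *)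

(* Defs.v *)
From Stdlib Require Import ClassicalEpsilon.
From mathcomp Require Import all_boot.

Set Implicit Arguments.
Unset Strict Implicit.
Unset Printing Implicit Defensive.

Definition is_max (P : nat -> Prop) (x : nat) : Prop :=
  P x /\ forall y, P y -> y <= x.

(* Unspecified when P has no maximum: a bound on [max_of P] is provable only
   together with the existence of the maximum. *)
Definition max_of (P : nat -> Prop) : nat := epsilon (inhabits 0) (is_max P).

(* A bipartite graph with parts A and B is given by its adjacency e : A -> B. *)
Section Bipartite.
Variables (A B : finType) (e : A -> B -> bool).

Definition neighbours (a : A) : {set B} := [set b | e a b].

Definition common_neighbours (S : {set A}) : {set B} :=
  [set b | [forall a in S, e a b]].

End Bipartite.

Definition w_admissible (n m r s k : nat) : Prop :=
  exists (A B : finType) (e : A -> B -> bool),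
    [/\ #|A| = n, #|B| = m,
        forall a : A, k <= #|neighbours e a|
      & forall S : {set A}, #|S| = r -> #|common_neighbours e S| <= s].

Definition w (n m r s : nat) : nat := max_of (w_admissible n m r s).

Section Hypergraph.
Variable V : finType.
Implicit Types (P Q E : {set {set V}}) (T : {set V}).

Definition induced_edges E Q : {set {set V}} :=
  [set X in E | X \subset cover Q].

(* P is the set of parts, E the set of edges. *)
Definition is_nkrs_graph (n k r s : nat) P E : Prop :=
  [/\ forall X, X \in E -> #|X| = r,
      partition P [set: V],
      #|P| = n,
      forall p, p \in P -> #|p| = k
    & forall Q, Q \subset P -> #|Q| = r ->
        [/\ #|induced_edges E Q| = s,
            forall X p, X \in induced_edges E Q -> p \in Q -> #|X :&: p| = 1
          & trivIset (induced_edges E Q)]].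

Definition independent_transversal P E T : Prop :=
  is_transversal T P [set: V] /\ forall X, X \in E -> ~~ (X \subset T).

End Hypergraph.

Definition f_admissible (k r s n : nat) : Prop :=
  0 < n /\
  forall (V : finType) (P E : {set {set V}}), is_nkrs_graph n k r s P E ->
    exists T : {set V}, independent_transversal P E T.

Definition f (k r s : nat) : nat := max_of (f_admissible k r s).

(* Main.v *)
Require Import Defs.
From Stdlib Require Import ClassicalEpsilon.
From mathcomp Require Import all_boot.

Set Implicit Arguments.
Unset Strict Implicit.
Unset Printing Implicit Defensive.

(** Let [e] be a bipartite graph witnessing [w n m r s >= k], and keep exactly
    [k] neighbours [N a] of every vertex [a] of its first part [A].  Build an
    [r]-graph whose parts are indexed by [A], the part of [a] being the set of
    pairs [(a, b)] with [b] in [N a].  Any [r] indices, forming a set [S], have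
    at most [s] common neighbours, and [s <= k], so the [s] edges that the parts
    of [S] must induce can be chosen to include [{(a, b) : a in S}] for every
    common neighbour [b].  A transversal assigns to each [a] an element [b] of
    [N a]; since [m * (r - 1) < n], some [b] is assigned to [r] different
    indices, which form a set [S] having [b] as a common neighbour.  The edge
    [{(a, b) : a in S}] then lies inside the transversal, so no transversal is
    independent.

    To pick all the edges at once and uniformly in [S], each part is listed
    with the common neighbours of [S] first, always in the same order; the
    [j]-th edge on [S] collects the [j]-th vertex of each of the parts of [S]
    ([rank], [edge]).  The edges on [S] are the fibres of a function that is
    injective on each part, which makes them disjoint transversals of the parts
    of [S] ([vertex_graph_nkrs]).

    As [f] is a maximum over all numbers of parts, the conclusion requires a
    graph without independent transversal with [y] parts for every [y >= n],
    not just for [n].  The extra indices receive copies of one of the sets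
    [N a]: the bound on common neighbours is needed only within a set [A0] of
    indices large enough for the pigeonhole argument
    ([no_independent_transversal]).
    Finally, [max_of] is a genuine maximum for [w] and for [f], as the
    predicates are nonempty and bounded ([max_ofP]). *)

(** * Maxima, subsets and the pigeonhole principle *)

Lemma bounded_has_max (P : nat -> Prop) x b :
  P x -> (forall y, P y -> y <= b) -> exists z, is_max P z.
Proof.
move=> Px; elim: b => [|b IHb] leb.
  by exists x; split=> // y /leb; rewrite leqn0 => /eqP ->.
have [Pb|nPb] := excluded_middle_informative (P b.+1).
  by exists b.+1.
apply: IHb => y Py; have := leb _ Py; rewrite leq_eqVlt => /orP[/eqP y_b|//].
by rewrite y_b in Py.
Qed.

Lemma max_ofP (P : nat -> Prop) x b :
  P x -> (forall y, P y -> y <= b) -> is_max P (max_of P).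
Proof. by move=> Px leb; exact: epsilon_spec (bounded_has_max Px leb). Qed.

Lemma exists_subset_card (T : finType) (X : {set T}) k :
  k <= #|X| -> exists2 Y : {set T}, Y \subset X & #|Y| = k.
Proof.
case/card_geqP=> t [t_uniq <- tX]; exists [set x in t].
  by apply/subsetP=> x; rewrite inE => /tX.
by rewrite cardsE; apply/card_uniqP.
Qed.

Lemma large_fibre (A B : finType) (g : A -> B) (A0 : {set A}) r :
  #|B| * (r - 1) < #|A0| -> exists b, r <= #|[set a in A0 | g a == b]|.
Proof.
move=> large; apply/existsP; apply: contraLR large => /existsPn small.
rewrite -leqNgt -sum1_card (partition_big g predT) //= -sum_nat_const.
apply: leq_sum => b _; move: (small b); rewrite -ltnNge sum1dep_card.
by case: r {small} => // r'; rewrite subn1.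
Qed.

(** * The hypergraph of a family of sets *)

Section Construction.
Variables (A B : finType) (N : A -> {set B}) (k r s : nat).
Hypotheses (r_ge2 : 2 <= r) (k_gt0 : 0 < k) (s_le_k : s <= k).
Hypothesis card_N : forall a, #|N a| = k.
Implicit Types (S : {set A}) (a : A) (b : B).

Definition vertex : finType := {x : A * B | x.2 \in N x.1}.
Implicit Types (u v : vertex).

Definition host v : A := (val v).1.
Definition label v : B := (val v).2.
Definition part a : {set vertex} := [set v | host v == a].
Definition parts : {set {set vertex}} := [set part a | a in A].

Definition common S : {set B} := common_neighbours (fun a b => b \in N a) S.

(** Listing the common labels first gives them the same position in all the
    parts of [S], and this position is less than their number. *)
Definition listing S a : seq B := enum (common S) ++ enum (N a :\: common S).
Definition rank S v : nat := index (label v) (listing S (host v)).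
Definition edge S j : {set vertex} := [set v | (host v \in S) && (rank S v == j)].

Definition edges : {set {set vertex}} :=
  [set X | [exists S : {set A}, (#|S| == r) && [exists j : 'I_s, X == edge S j]]].

Lemma edgesP X :
  reflect (exists S j, [/\ #|S| = r, j < s & X = edge S j]) (X \in edges).
Proof.
rewrite inE; apply: (iffP existsP) => [[S /andP[/eqP cS /existsP[j /eqP ->]]]|].
  by exists S, j.
move=> [S [j [cS j_lt ->]]]; exists S; rewrite cS eqxx /=.
by apply/existsP; exists (Ordinal j_lt).
Qed.

Lemma commonS S a : a \in S -> common S \subset N a.
Proof.
by move=> aS; apply/subsetP=> b; rewrite inE => /forallP/(_ a)/implyP; apply.
Qed.

Lemma listing_uniq S a : uniq (listing S a).
Proof.
rewrite cat_uniq !enum_uniq /= andbT; apply/hasPn => b.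
by rewrite !mem_enum inE => /andP[].
Qed.

Lemma mem_listing S a : a \in S -> listing S a =i N a.
Proof.
move=> /commonS/subsetP sub b; rewrite mem_cat !mem_enum in_setD.
by have [/sub ->|//] := boolP (b \in common S).
Qed.

Lemma size_listing S a : a \in S -> size (listing S a) = k.
Proof.
move=> aS; rewrite -(card_N a) -(eq_card (mem_listing aS)).
by apply/esym/card_uniqP/listing_uniq.
Qed.

Lemma label_listing S v : host v \in S -> label v \in listing S (host v).
Proof. by move=> vS; rewrite mem_listing //; exact: (valP v). Qed.

Lemma vertex_eq u v : host u = host v -> label u = label v -> u = v.
Proof.
move=> eqh eql; apply: val_inj; rewrite [LHS]surjective_pairing.
by rewrite [RHS]surjective_pairing; congr pair.
Qed.

Lemma rank_inj S u v :
  host u \in S -> host u = host v -> rank S u = rank S v -> u = v.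
Proof.
move=> uS eqh eqr; apply: vertex_eq => //; move: eqr.
rewrite /rank -eqh => /(index_inj (label u)); apply.
  exact: label_listing.
by rewrite eqh; apply: label_listing; rewrite -eqh.
Qed.

Lemma rank_surj S a j :
  a \in S -> j < k -> exists2 v, host v = a & rank S v = j.
Proof.
move=> aS; rewrite -(size_listing aS) => j_lt.
have [b0 _] : exists b, b \in N a.
  by apply/set0Pn; rewrite -card_gt0 card_N.
have bN : nth b0 (listing S a) j \in N a by rewrite -(mem_listing aS) mem_nth.
exists (exist _ (a, nth b0 (listing S a) j) bN : vertex) => //.
by rewrite /rank index_uniq // listing_uniq.
Qed.

Lemma card_edge_part S a j : a \in S -> j < k -> #|edge S j :&: part a| = 1.
Proof.
move=> aS j_lt; have [v hv rv] := rank_surj aS j_lt.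
apply/eqP/cards1P; exists v; apply/setP=> u; rewrite !inE.
apply/andP/eqP => [[/andP[uS /eqP ru] /eqP hu]|->].
  by apply: (rank_inj uS); rewrite ?hu ?hv ?ru.
by rewrite hv rv aS !eqxx.
Qed.

Lemma host_edge S j : j < k -> [set host v | v in edge S j] = S.
Proof.
move=> j_lt; apply/setP=> a; apply/imsetP/idP => [[v]|aS].
  by rewrite inE => /andP[vS _ ->].
have [v hv rv] := rank_surj aS j_lt.
by exists v; rewrite // inE hv rv aS eqxx.
Qed.

Lemma card_edge S j : j < k -> #|edge S j| = #|S|.
Proof.
move=> j_lt; rewrite -{2}(host_edge S j_lt) card_in_imset // => u v.
rewrite !inE => /andP[uS /eqP ru] /andP[_ /eqP rv] eqh.
by apply: (rank_inj uS); rewrite ?ru ?rv.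
Qed.

Lemma part_neq0 a : exists v, v \in part a.
Proof.
have [v hv _] := rank_surj (set11 a) k_gt0.
by exists v; rewrite inE hv.
Qed.

Lemma part_inj : injective part.
Proof.
move=> a a' eqp; have [v va] := part_neq0 a; move: (va).
by rewrite eqp; move: va; rewrite !inE => /eqP -> /eqP.
Qed.

Lemma parts_partition : partition parts [set: vertex].
Proof.
apply/and3P; split.
- apply/eqP/setP=> v; rewrite inE; apply/bigcupP.
  by exists (part (host v)); rewrite ?imset_f // inE.
- apply/trivIsetP => _ _ /imsetP[a _ ->] /imsetP[a' _ ->] neq.
  rewrite -setI_eq0; apply/eqP/setP=> v; rewrite !inE.
  by apply: contraNF neq => /andP[/eqP <- /eqP <-].
- apply/imsetP => -[a _ eq0]; have [v] := part_neq0 a.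
  by rewrite -eq0 inE.
Qed.

Lemma card_parts : #|parts| = #|A|.
Proof. by rewrite card_imset //; apply: part_inj. Qed.

Lemma card_part a : #|part a| = k.
Proof.
rewrite -(card_N a) -(@card_in_imset _ _ label (part a)).
  apply: eq_card => b; apply/imsetP/idP => [[v]|bN].
    by rewrite inE => /eqP <- ->; exact: (valP v).
  by exists (exist _ (a, b) bN : vertex); rewrite ?inE.
by move=> u v; rewrite !inE => /eqP hu /eqP hv; apply: vertex_eq; rewrite hu.
Qed.

(** Each edge meets the parts of exactly [r] indices, so an edge inside the
    union of [r] parts lies on the indices of these parts. *)
Lemma induced_edgesP S X : #|S| = r ->
  reflect (exists2 j, j < s & X = edge S j)
          (X \in induced_edges edges [set part a | a in S]).
Proof.
move=> cS; have coverP v : (v \in cover [set part a | a in S]) = (host v \in S).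
  apply/bigcupP/idP => [[_ /imsetP[a aS ->]]|vS].
    by rewrite inE => /eqP ->.
  by exists (part (host v)); rewrite ?imset_f // inE.
rewrite inE; apply: (iffP andP) => [[/edgesP[S' [j [cS' j_lt ->]]] sub]|].
  exists j => //; congr edge; apply/eqP; rewrite eqEcard cS cS' leqnn andbT.
  rewrite -(host_edge S' (leq_trans j_lt s_le_k)).
  by apply/subsetP=> _ /imsetP[v /(subsetP sub) + ->]; rewrite coverP.
move=> [j j_lt ->]; split; first by apply/edgesP; exists S, j.
by apply/subsetP=> v; rewrite coverP inE => /andP[].
Qed.

Lemma vertex_graph_nkrs : is_nkrs_graph #|A| k r s parts edges.
Proof.
split; [|exact: parts_partition|exact: card_parts| |].
- move=> _ /edgesP[S [j [cS j_lt ->]]].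
  by rewrite card_edge // (leq_trans j_lt).
- by move=> _ /imsetP[a _ ->]; apply: card_part.
move=> Q subQ; set S := [set a | part a \in Q].
have {subQ} -> : Q = [set part a | a in S].
  apply/setP=> p; apply/idP/imsetP => [pQ|[a + ->]]; last by rewrite inE.
  have /imsetP[a _ pa] := subsetP subQ _ pQ.
  by exists a; rewrite // inE -pa.
rewrite card_imset => [cS|]; last exact: part_inj.
split.
- have -> : induced_edges edges [set part a | a in S] =
            [set edge S (val j) | j in 'I_s].
    apply/setP=> X; apply/(induced_edgesP _ cS)/imsetP => [[j j_lt ->]|].
      by exists (Ordinal j_lt).
    by move=> [j _ ->]; exists j.
  rewrite card_imset ?card_ord // => i j eq_edge; apply: val_inj.
  have [a aS] : exists a, a \in S.
    by apply/set0Pn; rewrite -card_gt0 cS (leq_trans _ r_ge2).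
  have [v hv rv] := rank_surj aS (leq_trans (ltn_ord i) s_le_k).
  have: v \in edge S i by rewrite inE hv rv aS eqxx.
  by rewrite eq_edge inE rv => /andP[_ /eqP].
- move=> _ p /(induced_edgesP _ cS)[j j_lt ->] /imsetP[a aS ->].
  by rewrite card_edge_part // (leq_trans j_lt).
apply/trivIsetP => X Y /(induced_edgesP _ cS)[i _ ->].
move=> /(induced_edgesP _ cS)[j _ ->] neq.
rewrite -setI_eq0; apply/eqP/setP=> v; rewrite !inE.
by apply: contraNF neq => /andP[/andP[_ /eqP <-] /andP[_ /eqP <-]].
Qed.

(** If [r] indices of [A0] are given the same label [b] by the transversal,
    then [b] is one of the at most [s] common labels of the set [S] of these
    indices, so its position in every listing for [S] is less than [s] and
    defines an edge, whose vertices all belong to the transversal. *)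
Lemma no_independent_transversal (A0 : {set A}) T :
  (forall S, S \subset A0 -> #|S| = r -> #|common S| <= s) ->
  #|B| * (r - 1) < #|A0| ->
  ~ independent_transversal parts edges T.
Proof.
move=> few_common large [/and3P[_ _ /forall_inP T_meets] T_indep].
have /fin_all_exists2 [t tT ht] a : exists2 v, v \in T & host v = a.
  have /T_meets/cards1P[v eqv] : part a \in parts by apply: imset_f.
  have : v \in T :&: part a by rewrite eqv set11.
  by rewrite !inE => /andP[vT /eqP hv]; exists v.
have [b /exists_subset_card[S subS cS]] := large_fibre (label \o t) large.
have label_t a : a \in S -> label (t a) = b.
  by move/(subsetP subS); rewrite inE => /andP[_ /eqP].
have bS : b \in common S.
  rewrite inE; apply/forall_inP => a aS.
  by rewrite -(label_t a aS) -{2}(ht a); exact: (valP (t a)).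
have rank_b v : label v = b -> rank S v = index b (enum (common S)).
  by move=> lv; rewrite /rank lv index_cat mem_enum bS.
have subA0 : S \subset A0.
  by apply/subsetP=> a /(subsetP subS); rewrite inE => /andP[].
have j_lt : index b (enum (common S)) < s.
  by apply: leq_trans (few_common S subA0 cS); rewrite cardE index_mem mem_enum.
have /T_indep/negP : edge S (index b (enum (common S))) \in edges.
  by apply/edgesP; exists S, (index b (enum (common S))).
apply; apply/subsetP => v; rewrite inE => /andP[vS /eqP rv].
suff -> : v = t (host v) by [].
apply: (rank_inj vS); first by rewrite ht.
by rewrite rv rank_b // label_t.
Qed.

End Construction.

(** * The two maxima *)

Lemma w_is_max n m r s :
  0 < n -> 0 < r -> is_max (w_admissible n m r s) (w n m r s).
Proof.
move=> n_gt0 r_gt0; apply: (@max_ofP _ 0 m).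
  exists 'I_n, 'I_m, (fun _ _ => false); split; rewrite ?card_ord // => S cS.
  rewrite eq_card0 // => b; rewrite inE; apply/negbTE/forall_inP => no_nbr.
  by have /set0Pn[a /no_nbr] : S != set0 by rewrite -card_gt0 cS.
move=> y [A [B [e [cA cB deg _]]]]; rewrite -cB.
have /card_gt0P[a _] : 0 < #|A| by rewrite cA.
exact: leq_trans (deg a) (max_card _).
Qed.

Lemma f_admissible1 k r s : 0 < k -> 2 <= r -> f_admissible k r s 1.
Proof.
move=> k_gt0 r_ge2; split=> // V P E [cE partP /eqP cP cp _].
exists (transversal P [set: V]); have T_trans := transversalP partP.
split=> // X /cE cX; apply/negP => /subset_leq_card.
by rewrite (card_transversal T_trans) cX (eqP cP) leqNgt r_ge2.
Qed.

(** A graph with more than [n] parts arises from the hypergraph of a family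
    indexed by [A] enlarged with duplicates of one of its indices; repeated
    sets have too many common elements, but the pigeonhole argument is confined
    to the original indices. *)
Lemma not_f_admissible n m k r s y :
  2 <= r -> 0 < k -> s <= k -> m * (r - 1) < n -> n <= y ->
  w_admissible n m r s k -> ~ f_admissible k r s y.
Proof.
move=> r_ge2 k_gt0 s_le_k m_lt_n le_ny [A [B [e [cA cB deg few]]]] [_ adm].
have /fin_all_exists2[N subN cN] a := exists_subset_card (deg a).
have /card_gt0P[a0 _] : 0 < #|A| by rewrite cA (leq_ltn_trans _ m_lt_n).
pose I : finType := (A + 'I_(y - n))%type.
pose N' (i : I) := if i is inl a then N a else N a0.
have cN' i : #|N' i| = k by case: i => [a|j]; apply: cN.
have := vertex_graph_nkrs r_ge2 k_gt0 s_le_k cN'.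
rewrite card_sum cA card_ord subnKC // => /adm[T].
have inl_inj : injective (inl : A -> I) by move=> a a' [].
apply: (no_independent_transversal (A0 := inl @: [set: A])).
  move=> S subS cS; set S0 := inl @^-1: S.
  have eqS : S = inl @: S0.
    apply/setP=> i; apply/idP/imsetP => [iS|[a + ->]]; last by rewrite inE.
    have /imsetP[a _ ia] := subsetP subS _ iS.
    by exists a; rewrite // inE -ia.
  have /few : #|S0| = r by rewrite -cS eqS card_imset.
  apply: leq_trans; apply/subset_leq_card/subsetP => b.
  rewrite !inE => /forall_inP bS; apply/forall_inP => a; rewrite inE => aS.
  by have /(subsetP (subN a)) := bS _ aS; rewrite inE.
by rewrite card_imset // cardsT cB cA.
Qed.

Theorem lemma1p7 (n m k r s : nat)
    (n_gt0 : 0 < n) (m_gt0 : 0 < m) (k_gt0 : 0 < k) (s_gt0 : 0 < s)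
    (r_ge2 : 2 <= r) (s_le_k : s <= k)
    (w_ge_k : k <= w n m r s) (m_lt_n : m * (r - 1) < n) :
  f k r s < n.
Proof.
have [[A [B [e [cA cB deg few]]]] _] := w_is_max m s n_gt0 (ltnW r_ge2).
have w_k : w_admissible n m r s k.
  by exists A, B, e; split=> // a; apply: leq_trans (deg a).
have bound y : f_admissible k r s y -> y <= n.-1.
  move=> adm; rewrite -ltnS prednK // ltnNge; apply/negP => le_ny.
  exact: (not_f_admissible r_ge2 k_gt0 s_le_k m_lt_n le_ny w_k).
have [/bound le_f _] := max_ofP (f_admissible1 s k_gt0 r_ge2) bound.
by rewrite -(prednK n_gt0) ltnS.
Qed.
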